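(* For every infinite cardinal number $\kappa$ the following are equivalent: (1) $\kappa<\mathrm{cov}(\mathcal{M})$. (2) For each $\mathsf{T}_1$ topological space $(X,\tau)$ without isolated points such that $\delta_{\theta}(X)=\aleph_0$ and $\pi_{\theta}(X)\le\kappa$, player ONE has no winning strategy in the game $\mathsf{G}_1(\mathcal{D}_{\theta},\mathcal{D}_{\theta})$ played on $X$. (3) For each $\mathsf{T}_1$ topological space $(X,\tau)$ without isolated points such that $\delta_{\theta}(X)=\aleph_0$ and $\pi_{\theta}(X)\le\kappa$, the selection principle $\mathsf{S}_1(\mathcal{D}_{\theta},\mathcal{D}_{\theta})$ holds for $X$.
   Context: All spaces are nonempty. $\mathrm{cov}(\mathcal{M})$ is the least cardinality of a family of meager subsets of the real line whose union is the whole real line. For a topological space $(X,\tau)$ and $A\subseteq X$, the $\theta$-closure of $A$ is $cl_{\theta}(A)=\{x\in X:\text{ for every neighborhood }U\text{ of }x,\ \overline{U}\cap A\neq\emptyset\}$, where $\overline{U}$ is the closure of $U$ in $\tau$. A set $D\subseteq X$ is $\theta$-dense if $cl_{\theta}(D)=X$. $\mathcal{D}_{\theta}$ denotes the family of all $\theta$-dense subsets of $X$. $\delta_{\theta}(X)$ is the least cardinal $\lambda\ge\aleph_0$ such that each $\theta$-dense $D\subseteq X$ contains a $\theta$-dense (in $X$) set $C\subseteq D$ with $|C|\le\lambda$. A family $\mathcal{V}$ of nonempty open subsets of $X$ is a $\theta$-$\pi$-base for $X$ if for every nonempty open $U\subseteq X$ there is $V\in\mathcal{V}$ with $V\subseteq\overline{U}$.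 $\pi_{\theta}(X)$ is the least cardinality of a $\theta$-$\pi$-base for $X$. For families of sets $\mathcal{A}$, $\mathcal{B}$: $\mathsf{S}_1(\mathcal{A},\mathcal{B})$ is the statement that for each sequence $(A_n:n<\omega)$ of elements of $\mathcal{A}$ there is a sequence $(b_n:n<\omega)$ with $b_n\in A_n$ for each $n$ and $\{b_n:n<\omega\}\in\mathcal{B}$. The game $\mathsf{G}_1(\mathcal{A},\mathcal{B})$ between players ONE and TWO has length $\omega$: in inning $n<\omega$ ONE chooses $O_n\in\mathcal{A}$ and TWO responds with $T_n\in O_n$. TWO wins the play $O_0,T_0,O_1,T_1,\dots$ if $\{T_n:n<\omega\}\in\mathcal{B}$; otherwise ONE wins. A strategy for a player is a function assigning to each finite sequence of previous moves of the opponent a legal next move; it is winning if the player wins every play in which the strategy is followed. *)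

(* Defs.v *)
From mathcomp Require Import all_boot all_order all_algebra.
From mathcomp Require Import all_classical all_reals all_analysis.
Import numFieldNormedType.Exports.

Set Implicit Arguments.
Unset Strict Implicit.
Unset Printing Implicit Defensive.

Local Open Scope classical_set_scope.
Local Open Scope card_scope.

(* A cardinal number is represented by a type of that cardinality: [L] stands
   for |L|, so equality and order of cardinals are [card_eq] and [card_le] on
   full sets. *)
Definition cardinal_eq (K L : Type) : Prop := [set: K] #= [set: L].

Definition cardinal_le (K L : Type) : Prop := [set: K] #<= [set: L].

Definition cardinal_lt (K L : Type) : Prop :=
  cardinal_le K L /\ ~ cardinal_le L K.

Definition is_least_cardinal (P : Type -> Prop) (L : Type) : Prop :=
  P L /\ forall M : Type, P M -> cardinal_le L M.

(* The value is meaningful when [P] is invariant under equipotence and holds of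
   some type: a least cardinal then exists because cardinals are well-ordered,
   and it is unique up to equipotence. *)
Definition least_cardinal (P : Type -> Prop) : Type :=
  if pselect (exists L : Type, is_least_cardinal P L) is left h
  then sval (cid h) else Empty_set.

Definition nowhere_dense (T : topologicalType) (A : set T) : Prop :=
  interior (closure A) = set0.

Definition meager (T : topologicalType) (A : set T) : Prop :=
  exists N : nat -> set T,
    (forall n, nowhere_dense (N n)) /\ A = \bigcup_n N n.

Definition cov_meager (R : realType) : Type :=
  least_cardinal (fun L => exists F : set (set R),
    [/\ forall A, F A -> meager A,
        \bigcup_(A in F) A = [set: R]
      & F #= [set: L]]).

Section theta.
Variable X : topologicalType.

Definition theta_closure (A : set X) : set X :=
  [set x | forall U : set X, nbhs x U -> closure U `&` A !=set0].

Definition theta_dense : set (set X) :=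
  [set D | theta_closure D = [set: X]].

Definition delta_theta : Type :=
  least_cardinal (fun L => cardinal_le nat L /\
    forall D : set X, theta_dense D ->
      exists C : set X, [/\ C `<=` D, theta_dense C & C #<= [set: L]]).

Definition theta_pi_base (V : set (set X)) : Prop :=
  (forall B, V B -> open B /\ B !=set0) /\
  (forall U : set X, open U -> U !=set0 ->
     exists2 B, V B & B `<=` closure U).

Definition pi_theta : Type :=
  least_cardinal (fun L => exists V : set (set X),
    theta_pi_base V /\ V #= [set: L]).

End theta.

Arguments theta_dense : clear implicits.

Section selection.
Variables (X : Type) (A B : set (set X)).

Definition S1 : Prop :=
  forall O : nat -> set X, (forall n, A (O n)) ->
    exists b : nat -> X, (forall n, O n (b n)) /\ B (range b).

(* The argument of [sigma] is the list of TWO's previous moves, oldest first. *)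
Definition strategy_ONE (sigma : seq X -> set X) : Prop :=
  forall s : seq X, A (sigma s).

(* The play of [G_1(A,B)] in which ONE follows [sigma] and TWO's moves are
   [t 0, t 1, ...]; TWO obeys the rules. *)
Definition play_against (sigma : seq X -> set X) (t : nat -> X) : Prop :=
  forall n, sigma (mkseq t n) (t n).

Definition winning_ONE (sigma : seq X -> set X) : Prop :=
  strategy_ONE sigma /\
  forall t : nat -> X, play_against sigma t -> ~ B (range t).

Definition ONE_has_winning_strategy_G1 : Prop :=
  exists sigma : seq X -> set X, winning_ONE sigma.

End selection.

(* [topologicalType] does not exclude the empty space. *)
Definition admissible_space (K : Type) (X : topologicalType) : Prop :=
  [/\ [set: X] !=set0,
      accessible_space X,
      isolated [set: X] = set0,
      cardinal_eq (delta_theta X) nat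
    & cardinal_le (pi_theta X) K].

(* Main.v *)
Require Import Defs.
From HB Require Import structures.
From mathcomp Require Import all_boot all_order all_algebra.
From mathcomp Require Import all_classical all_reals all_analysis.
From mathcomp Require Import ring lra.
Import numFieldNormedType.Exports.
Import Order.TTheory GRing.Theory Num.Theory.

(** Why the theorem is true.

    The bridge between category on the real line and selections from dense
    sets is Bartoszynski's description of cov(M): a cardinal K lies below
    cov(M) exactly when any K functions from nat to nat can be guessed, that
    is, some single g agrees with each of them in at least one place
    ([guessable]).  A reformulation is that K dense subsets of the binary tree
    always have a common branch ([generic_branch]).  The proof goes round the
    following circle.

    - K < cov(M) gives guessing ([cov_meager_guessable]): from a real x a
      function is read off in such a way that, for fixed f, the reals whose
      function differs from f everywhere form a nowhere dense set.  If no g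
      guessed all of K functions, K such sets would cover the line.

    - Guessing gives generic branches ([guessable_generic_branch]).  A dense
      subset of the binary tree has, above every level n, a window such that
      one fixed pattern on this window brings all branches into the set.
      Guessing bounds first yields one interval partition that swallows
      windows of each of the K dense sets infinitely often; guessing the
      patterns on the pieces of this partition then assembles a branch.

    - Generic branches defeat every strategy of ONE ([generic_branch_ONE]).
      Against a given strategy, choose countable theta-dense subsets of all the
      sets that ONE may play; a bit sequence then encodes a sequence of moves
      of TWO.  For a member V of a theta-pi-base, the finite bit strings
      forcing TWO to enter the closure of V are dense, so a branch through all
      of these sets yields a theta-dense play.

    - If S1 fails, ONE wins by playing a sequence that witnesses the failure.

    - The selection principle gives guessing ([S1_guessable]).  Given K
      functions, there is a countable zero-dimensional space in which each
      function f determines a clopen set and a point of the n-th of countably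
      many dense sets makes finitely many guesses about each function; a
      selection meeting the clopen set of f contains a correct guess about f
      ([S1_guess_space]).  The guesses allowed in different dense sets concern
      different arguments, hence the selection amalgamates into one function.

    - Generic branches give K < cov(M) ([generic_branch_cov_meager]), by
      reading a branch as a binary expansion: every string extends to one whose
      cylinder avoids a given nowhere dense set.

    The cardinal arithmetic behind this is that cardinals are well-ordered
    ([exists_least_type]), so that the least cardinals in the definitions exist,
    and that K * K has the size of K for infinite K ([cardinal_le_square]),
    which bounds the pi-base of the countable space and the number of nowhere
    dense sets making up K meager sets. *)

Set Implicit Arguments.
Unset Strict Implicit.
Unset Printing Implicit Defensive.

Local Open Scope classical_set_scope.

(** * Cardinal arithmetic *)

Lemma cardinal_leP (K L : Type) :
  cardinal_le K L <-> exists f : K -> L, injective f.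
Proof.
split=> [/card_leP[f]|[f f_inj]].
  exists (fun x => val (f (SigSub (in_setT x)))) => x y /val_inj.
  by move=> /(inj (in_setT _) (in_setT _))[].
apply: card_le_trans (card_leT (range f)).
have : (range f #= [set: K])%card by apply: inj_card_eq => x y _ _; exact: f_inj.
by rewrite card_eq_le => /andP[].
Qed.

Lemma cardinal_le_refl K : cardinal_le K K.
Proof. exact: card_lexx. Qed.

Lemma cardinal_le_trans K L M :
  cardinal_le K L -> cardinal_le L M -> cardinal_le K M.
Proof. exact: card_le_trans. Qed.

Lemma cardinal_le_set T (A : set T) L :
  (A #<= [set: L])%card -> cardinal_le A L.
Proof.
move=> AL; apply: card_le_trans AL.
by rewrite (card_le_eql (card_setT A)) card_lexx.
Qed.

(** Cardinals are well-ordered (Honig's argument).  Among the sets of choice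
    functions that pairwise differ in every coordinate take a maximal one S.
    Some projection of S is onto [M i], for otherwise the values missed in all
    coordinates form a choice function that could be added.  Then S is a copy
    of [M i] that every other projection embeds. *)
Lemma exists_least_type (I : Type) (i0 : I) (M : I -> Type) :
  exists i, forall j, cardinal_le (M i) (M j).
Proof.
pose P (S : set (forall i, M i)) :=
  forall x y, S x -> S y -> (exists i, x i = y i) -> x = y.
have [|S [PS Smax]] := @Zorn_bigcup _ P.
  move=> F FP Ftot x y [A FA Ax] [B FB By].
  have [AB|BA] := Ftot _ _ FA FB.
    by apply: (FP _ FB) => //; exact: AB.
  by apply: (FP _ FA) => //; exact: BA.
have [i Si] : exists i, forall m : M i, exists2 x, S x & x i = m.
  apply: contrapT => /forallNP noi.
  have {}noi i : exists m : M i, forall x, S x -> x i <> m.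
    have /existsNP[m nm] := noi i; exists m => x Sx xim.
    by apply: nm; exists x.
  pose z i := sval (cid (noi i)).
  have zP i x : S x -> x i <> z i by exact: (svalP (cid (noi i))).
  have nSz : ~ S z by move=> Sz; exact: (zP i0 z Sz).
  apply: (Smax (S `|` [set z])).
    by split=> [x ?|]; [left|move=> /(_ z (or_intror erefl))].
  move=> x y [Sx|->] [Sy|->] //; first exact: PS.
    by move=> [i /(zP i _ Sx)].
  by move=> [i /esym /(zP i _ Sy)].
exists i => j; apply/cardinal_leP.
pose f m := sval (cid2 (Si m)).
have Sf m : S (f m) by rewrite /f; case: cid2.
have fi m : f m i = m by rewrite /f; case: cid2.
exists (fun m => f m j) => m m' ff.
by rewrite -(fi m) -(fi m'); congr (_ i); apply: PS => //; exists j.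
Qed.

Lemma cardinal_le_total K L : cardinal_le K L \/ cardinal_le L K.
Proof.
have [[] le_i] := exists_least_type true (fun b : bool => if b then K else L).
  by left; exact: (le_i false).
by right; exact: (le_i true).
Qed.

Lemma cardinal_ltNge K L : ~ cardinal_lt K L -> cardinal_le L K.
Proof.
have [KL nlt|//] := cardinal_le_total K L.
by apply: contrapT => nLK; apply: nlt.
Qed.

(** Only subsets of one witness [L0] compete for the least cardinal, because
    any smaller type is equipotent to such a subset; this reduces the proper
    class of types to a family indexed by a type. *)
Lemma least_cardinalP (P : Type -> Prop) (L0 : Type) :
  (forall L M, cardinal_eq L M -> P L -> P M) -> P L0 ->
  is_least_cardinal P (least_cardinal P).
Proof.
move=> P_eq PL0.
have ex : exists L, is_least_cardinal P L.
  pose I := {A : set L0 | P (set_type A)}.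
  have PT : P [set: L0] by apply: P_eq PL0; rewrite /cardinal_eq card_eq_sym card_setT.
  have [[A PA] leA] := exists_least_type (exist _ [set: L0] PT : I)
    (fun i : I => set_type (sval i)).
  exists A; split=> // M PM.
  have [/cardinal_leP[f f_inj]|LM] := cardinal_le_total M L0; last first.
    apply: cardinal_le_trans LM.
    exact: cardinal_le_set (card_leT _).
  have fM : cardinal_eq (range f) M.
    rewrite /cardinal_eq (card_eql (card_setT _)).
    by apply: inj_card_eq => x y _ _; exact: f_inj.
  have PfM : P (range f).
    by apply: P_eq PM; rewrite /cardinal_eq card_eq_sym.
  apply: cardinal_le_trans (leA (exist _ (range f) PfM)) _ => /=.
  by move: fM; rewrite /cardinal_eq card_eq_le => /andP[].
rewrite /least_cardinal; case: pselect => // h.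
by case: cid.
Qed.

(** The junk value of [least_cardinal] is empty, so an element certifies that
    the least cardinal exists. *)
Lemma least_cardinal_inhabited (P : Type -> Prop) :
  least_cardinal P -> is_least_cardinal P (least_cardinal P).
Proof. by rewrite /least_cardinal; case: pselect => // h _; case: cid. Qed.

Lemma least_cardinal_unique (P : Type -> Prop) L :
  is_least_cardinal P L -> cardinal_eq (least_cardinal P) L.
Proof.
move=> PL; rewrite /least_cardinal; case: pselect => [h|[]]; last by exists L.
case: cid => M [PM leM] /=; rewrite /cardinal_eq card_eq_le.
by apply/andP; split; [apply: leM; exact: PL.1|apply: PL.2].
Qed.

(** Zorn's lemma, applied to the pairs of a subset A of K containing a fixed
    countable set and an injection of A * A into A.  For a maximal pair, either
    the complement of A embeds into A, and then K itself is coded in A, or A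
    embeds into its complement, and the copy of A in the complement leaves room
    to extend the injection, against maximality. *)
Lemma cardinal_le_square K :
  infinite_set [set: K] -> cardinal_le (K * K)%type K.
Proof.
move=> /infiniteP /cardinal_leP[e e_inj].
pose good (p : set K * (K -> K -> K)) := [/\ forall n, p.1 (e n),
  forall x y, p.1 x -> p.1 y -> p.1 (p.2 x y)
  & forall x y x' y', p.1 x -> p.1 y -> p.1 x' -> p.1 y' ->
      p.2 x y = p.2 x' y' -> x = x' /\ y = y'].
have [i ei] : exists i : K -> nat, forall n, i (e n) = n.
  have /choice[i iP] : forall x, exists n, forall m, e m = x -> m = n.
    move=> x; have [[n <-]|nx] := pselect (exists n, e n = x).
      by exists n => m /e_inj.
    by exists 0%N => m emx; case: nx; exists m.
  by exists i => n; apply/esym/iP.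
have base : good (range e, fun x y => e (pickle (i x, i y))).
  split=> /=; first by move=> n; exists n.
    by move=> x y _ _; eexists.
  move=> _ _ _ _ [a _ <-] [b _ <-] [c _ <-] [d _ <-] /e_inj.
  by rewrite !ei => /(pcan_inj pickleK)[-> ->].
pose T := {p | good p}.
pose R (p q : T) := `[< (sval p).1 `<=` (sval q).1 /\
  forall x y, (sval p).1 x -> (sval p).1 y ->
    (sval q).2 x y = (sval p).2 x y >].
have Rdef p q : reflect _ (R p q) := asboolP _.
have [|q r s /Rdef[qr fqr] /Rdef[rs frs]|C Ctot|[[A f] gA] Amax] :=
  @ZL_preorder T (exist _ _ base) R.
- by move=> t; apply/Rdef; split.
- apply/Rdef; split=> [|x y qx qy]; first exact: subset_trans qr rs.
  by rewrite frs ?fqr //; exact: qr.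
- have [[p0 Cp0]|C0] := pselect (exists p, C p); last first.
    by exists (exist _ _ base) => s Cs; case: C0; exists s.
  pose A := \bigcup_(p in C) (sval p).1.
  have Cmax p q : C p -> C q -> exists2 r, C r & R p r /\ R q r.
    move=> Cp Cq; have Rxx t : R t t by apply/Rdef; split.
    by have [?|?] := Ctot _ _ Cp Cq; [exists q|exists p].
  have A2 x y : A x -> A y -> exists2 p, C p & (sval p).1 x /\ (sval p).1 y.
    move=> [p Cp px] [q Cq qy].
    have [r Cr [/Rdef[pr _] /Rdef[qr _]]] := Cmax _ _ Cp Cq.
    by exists r => //; split; [exact: pr|exact: qr].
  have /choice[f fP] : forall xy : K * K, exists z, forall p, C p ->
      (sval p).1 xy.1 -> (sval p).1 xy.2 -> (sval p).2 xy.1 xy.2 = z.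
    move=> [x y] /=; have [[p [Cp [px py]]]|nxy] :=
      pselect (exists p, C p /\ (sval p).1 x /\ (sval p).1 y).
      exists ((sval p).2 x y) => q Cq qx qy.
      have [r Cr [/Rdef[_ pr] /Rdef[_ qr]]] := Cmax _ _ Cp Cq.
      by rewrite -pr// qr.
    by exists x => p Cp px py; case: nxy; exists p.
  have gAf : good (A, fun x y => f (x, y)).
    split=> /=.
    + by move=> n; exists p0 => //; case: (svalP p0).
    + move=> x y Ax Ay; have [p Cp [px py]] := A2 _ _ Ax Ay.
      exists p => //; rewrite -(fP (x, y) p)//=.
      by have [_ + _] := svalP p; apply.
    + move=> x y x' y' Ax Ay Ax' Ay'.
      have [p Cp [px py]] := A2 _ _ Ax Ay.
      have [q Cq [qx qy]] := A2 _ _ Ax' Ay'.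
      have [r Cr [/Rdef[pr _] /Rdef[qr _]]] := Cmax _ _ Cp Cq.
      rewrite -(fP (x, y) r)//= -?(fP (x', y') r)//=; try exact: pr; try exact: qr.
      by have [_ _ +] := svalP r; apply; by [apply: pr|apply: qr].
  exists (exist _ _ gAf) => p Cp; apply/Rdef; split=> [x px|x y px py] /=.
    by exists p.
  by rewrite -(fP (x, y) p).
have [/= Ae Af finj] := gA.
have [|] := cardinal_le_total (~` A) A; move=> /cardinal_leP[h0 h0_inj].
  have [h [hA h_inj]] : exists h : K -> K, (forall x, ~ A x -> A (h x)) /\
      forall x y, ~ A x -> ~ A y -> h x = h y -> x = y.
    pose h x := if pselect (~ A x) is left H
      then val (h0 (SigSub (mem_set (H : (~` A) x)))) else x.
    exists h; split=> [x nAx|x y nAx nAy]; rewrite /h.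
      by case: pselect => // H; exact: (set_valP (h0 _)).
    by do 2![case: pselect => // ?]; move=> /val_inj/h0_inj[].
  (* K embeds into A by tagging points with one of two elements of A. *)
  pose c x := if x \in A then f x (e 0%N) else f (h x) (e 1%N).
  have Ac x : A (c x).
    rewrite /c; case: ifPn => [/set_mem|/negP]; rewrite ?in_setE => ?;
      by apply: Af => //; exact: hA.
  apply/cardinal_leP; exists (fun p => f (c p.1) (c p.2)).
  have c_inj : injective c.
    move=> x y; rewrite /c.
    case: ifPn => [/set_mem Ax|/negP/=]; last (rewrite in_setE => nAx);
      (case: ifPn => [/set_mem Ay|/negP/=]; last (rewrite in_setE => nAy)).
    - by case/finj.
    - by case/finj => //; [exact: hA|move=> _ /e_inj].
    - by case/finj => //; [exact: hA|move=> _ /e_inj].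
    - by case/finj => //; [exact: hA|exact: hA|move=> + _; exact: h_inj].
  by move=> [x y] [x' y'] /= /finj[] // /c_inj -> /c_inj ->.
have [h [hA h_inj]] : exists h : K -> K, (forall x, A x -> ~ A (h x)) /\
    forall x y, A x -> A y -> h x = h y -> x = y.
  pose h x := if pselect (A x) is left H
    then val (h0 (SigSub (mem_set H))) else x.
  exists h; split=> [x Ax|x y Ax Ay]; rewrite /h.
    by case: pselect => // H; exact: (set_valP (h0 _)).
  by do 2![case: pselect => // ?]; move=> /val_inj/h0_inj[].
pose B := A `|` h @` A.
have /choice[u uP] : forall x, exists a, B x -> A a /\
    (x = if x \in A then a else h a).
  move=> x; have [Ax|nAx] := pselect (A x).
    by exists x => _; rewrite mem_set //; split.
  have [[a Aa ax]|nx] := pselect ((h @` A) x).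
    by exists a => _; rewrite memNset //; split.
  by exists x => -[].
(* The tag records which of the two arguments lie in A, so that pairs meeting
   the new part are sent injectively into the new part. *)
pose k (x y : K) := ((x \in A) + (y \in A).*2)%N.
pose g x y := if (x \in A) && (y \in A) then f x y
  else h (f (f (u x) (u y)) (e (k x y))).
have Auu x y : B x -> B y -> A (f (u x) (u y)).
  by move=> /uP[Ax _] /uP[Ay _]; exact: Af.
have Acode x y : B x -> B y -> A (f (f (u x) (u y)) (e (k x y))).
  by move=> Bx By; apply: Af => //; exact: Auu.
have gB : good (B, g).
  split=> /=.
  - by move=> n; left.
  - move=> x y Bx By; rewrite /g; case: ifPn => [/andP[/set_mem ? /set_mem ?]|_].
      by left; exact: Af.
    by right; eexists; last reflexivity; exact: Acode.
  move=> x y x' y' Bx By Bx' By'; rewrite /g.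
  have [[Ax ex] [Ay ey]] := (uP _ Bx, uP _ By).
  have [[Ax' ex'] [Ay' ey']] := (uP _ Bx', uP _ By').
  case: ifPn => [/andP[/set_mem ? /set_mem ?]|_];
    case: ifPn => [/andP[/set_mem ? /set_mem ?]|_].
  - exact: finj.
  - by move=> E; case: (hA _ (Acode _ _ Bx' By')); rewrite -E; exact: Af.
  - by move=> E; case: (hA _ (Acode _ _ Bx By)); rewrite E; exact: Af.
  move=> /(h_inj _ _ (Acode _ _ Bx By) (Acode _ _ Bx' By')).
  move=> /(finj _ _ _ _ (Auu _ _ Bx By) (Ae _) (Auu _ _ Bx' By') (Ae _)).
  move=> [/(finj _ _ _ _ Ax Ay Ax' Ay')[uu vv] /e_inj].
  move=> kk; have [hx hy] : (x \in A) = (x' \in A) /\ (y \in A) = (y' \in A).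
    by move: kk; rewrite /k; do 4!case: (_ \in A).
  by split; [rewrite [LHS]ex [RHS]ex' uu hx|rewrite [LHS]ey [RHS]ey' vv hy].
have RAB : R (exist _ _ gA) (exist _ _ gB).
  apply/Rdef; split=> [x Ax|x y Ax Ay] /=; first by left.
  by rewrite /g !mem_set.
have /Rdef[/= BA _] := Amax _ RAB.
by case: (hA _ (Ae 0%N)); apply: BA; right; exists (e 0%N).
Qed.

Lemma cardinal_le_mul_nat K :
  infinite_set [set: K] -> cardinal_le (K * nat)%type K.
Proof.
move=> Kinf; apply: cardinal_le_trans (cardinal_le_square Kinf).
have /infiniteP/cardinal_leP[e e_inj] := Kinf.
by apply/cardinal_leP; exists (fun p => (p.1, e p.2)) => -[x m] [y n] [-> /e_inj ->].
Qed.

Lemma cardinal_le_seq K :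
  infinite_set [set: K] -> cardinal_le (seq K) K.
Proof.
move=> Kinf; have /cardinal_leP[c c_inj] := cardinal_le_square Kinf.
have /infinite_setN0[k0 _] := Kinf.
apply: cardinal_le_trans (cardinal_le_mul_nat Kinf).
apply/cardinal_leP; exists (fun s => (foldr (fun a b => c (a, b)) k0 s, size s)).
elim=> [|a s IH] [|b t] //= [/c_inj[-> st] sz].
by congr (_ :: _); apply: IH; rewrite st sz.
Qed.

Lemma cardinal_le_enum T (A : set T) L :
  cardinal_le A L -> A !=set0 -> exists c : L -> T, range c = A.
Proof.
move=> /cardinal_leP[f f_inj] [a0 Aa0].
have /choice[c cP] : forall l, exists a, A a /\ forall b : A, f b = l -> val b = a.
  move=> l; have [[b <-]|nb] := pselect (exists b, f b = l).
    by exists (val b); split=> [|b' /f_inj ->//]; exact: set_valP.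
  by exists a0; split=> // b fb; case: nb; exists b.
exists c; apply/seteqP; split=> [_ [l _ <-]|a Aa]; first by have [] := cP l.
exists (f (SigSub (mem_set Aa))) => //.
by have [_ /(_ _ erefl)] := cP (f (SigSub (mem_set Aa))).
Qed.


(** * Guessing functions and branches of the binary tree *)

Definition guessable (K C : Type) : Prop :=
  forall Z : K -> nat -> C, exists g : nat -> C, forall k, exists i, g i = Z k i.

Definition generic_branch (K : Type) : Prop :=
  forall U : K -> set (seq bool),
    (forall k s, exists t, U k (s ++ t)) ->
    exists y : nat -> bool, forall k, exists n, U k (mkseq y n).

Lemma guessable_countable K (C : countType) :
  C -> guessable K nat -> guessable K C.
Proof.
move=> c0 Knat Z; have [g gZ] := Knat (fun k i => pickle (Z k i)).
exists (fun i => odflt c0 (unpickle (g i))) => k.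
by have [i gi] := gZ k; exists i; rewrite gi pickleK.
Qed.

Lemma generic_branch_le K L :
  cardinal_le L K -> generic_branch K -> generic_branch L.
Proof.
move=> /cardinal_leP[f f_inj] KC U Ud.
have [|y yU] := KC (fun k s => forall l, f l = k -> U l s).
  move=> k s; have [[m <-]|nm] := pselect (exists m, f m = k).
    by have [t Ut] := Ud m s; exists t => n /f_inj ->.
  by exists [::] => l fl; case: nm; exists l.
by exists y => l; have [n ny] := yU (f l); exists n; exact: ny.
Qed.

Lemma guessable_le K L (C : pointedType) :
  cardinal_le L K -> guessable K C -> guessable L C.
Proof.
move=> /cardinal_leP[f f_inj] KC Z.
have /choice[Z' ZZ'] : forall k, exists z : nat -> C, forall l, f l = k -> z = Z l.
  move=> k; have [[m <-]|nm] := pselect (exists m, f m = k).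
    by exists (Z m) => n /f_inj ->.
  by exists (fun=> point) => l fl; case: nm; exists l.
have [g gZ] := KC Z'; exists g => l.
by have [i gi] := gZ (f l); exists i; rewrite gi (ZZ' _ l).
Qed.

Lemma leq_strict_mono (j : nat -> nat) n :
  (forall i, j i < j i.+1)%N -> (n <= j n)%N.
Proof. by move=> jS; elim: n => // n IH; exact: leq_ltn_trans (jS n). Qed.

Lemma strict_mono_bracket (j : nat -> nat) N n :
  (forall i, j i < j i.+1)%N -> (j N <= n)%N ->
  exists i, (N <= i)%N /\ (j i <= n < j i.+1)%N.
Proof.
move=> jS jNn.
have ex : exists i, (j i <= n)%N && (N <= i)%N by exists N; rewrite jNn leqnn.
have bd i : (j i <= n)%N && (N <= i)%N -> (i <= n)%N.
  by move=> /andP[ji _]; exact: leq_trans (leq_strict_mono i jS) ji.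
case: (ex_maxnP ex bd) => i /andP[ji Ni] imax; exists i; split=> //.
rewrite ji /= ltnNge; apply/negP => jin.
by have := imax i.+1; rewrite jin (leq_trans Ni) // ltnn => /(_ isT).
Qed.

(** A guess of the iterated bound n |-> d k (d k n) gives a function G that
    is not dominated by any of these bounds, and the partition points are the
    iterates of G.  If G n exceeds the iterated bound at n, the two consecutive
    blocks [n, d k n) and [d k n, d k (d k n)) fit into two consecutive pieces,
    and wherever the common end of these pieces falls, one piece contains a
    whole block. *)
Lemma guessable_interval_partition K (d : K -> nat -> nat) :
  cardinal_le (K * nat)%type K -> guessable K nat ->
  (forall k n, n < d k n)%N ->
  exists2 j : nat -> nat, (j 0 = 0 /\ forall i, j i < j i.+1)%N &
    forall k N, exists i, (N <= i)%N /\
      exists n, (j i <= n)%N /\ (d k n <= j i.+1)%N.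
Proof.
move=> KN Kg dgt.
(* The pairs (k, N) shift the functions by N, so that the guess is correct
   beyond N for every N. *)
have [g gP] := guessable_le KN Kg
  (fun kN i => d kN.1 (d kN.1 (i + kN.2)))%N.
pose G n := (n.+1 + \sum_(i < n.+1) g i)%N.
have G_mono m n : (m <= n)%N -> (G m <= G n)%N.
  move=> mn; rewrite /G leq_add // -!(big_mkord xpredT).
  by rewrite (@big_cat_nat _ _ _ m.+1 0 n.+1)//= leq_addr.
have G_ge i n : (i <= n)%N -> (g i <= G n)%N.
  move=> le_in; rewrite /G (bigD1 (Ordinal (le_in : (i < n.+1)%N)))//=.
  by rewrite addnCA leq_addr.
pose j i := iter i G 0%N.
have jS i : (j i < j i.+1)%N by rewrite /j iterS /G leq_addr.
exists j => // k N.
have [i gi] := gP (k, j N); rewrite /= in gi.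
set n := (i + j N)%N in gi.
have Gn : (d k (d k n) <= G n)%N by rewrite -gi G_ge// leq_addr.
have [a [Na /andP[jan nja]]] := strict_mono_bracket jS (leq_addl i (j N)).
have dj : (d k (d k n) <= j a.+2)%N.
  by apply: leq_trans Gn _; apply: (G_mono n (j a.+1)); exact: ltnW.
have [dn|dn] := leqP (d k n) (j a.+1).
  by exists a; split=> //; exists n.
by exists a.+1; split; [exact: leqW|exists (d k n); split => //; exact: ltnW].
Qed.

(** For each k guess, at place n, a list of n + 1 pairs (x, h k x) with distinct
    x in [X k].  Going through the guessed lists in turn and keeping from the
    n-th one a pair whose first component is new yields a partial function; as
    only n components are used before, a correct list always contributes. *)
Lemma guessable_on_infinite K (C : countType) (c0 : C) (X : K -> set nat)
    (h : K -> nat -> C) :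
  guessable K nat -> (forall k N, exists2 x, (N <= x)%N & X k x) ->
  exists G : nat -> C, forall k, exists2 x, X k x & G x = h k x.
Proof.
move=> Kg Xinf.
have enumX k n : exists s, [/\ uniq (unzip1 s), size s = n &
    forall p : nat * C, p \in s -> X k p.1 /\ p.2 = h k p.1].
  elim: n => [|n [s [us sn sX]]]; first by exists [::].
  have [x xs Xx] := Xinf k (\max_(y <- unzip1 s) y).+1.
  exists ((x, h k x) :: s); split=> /=; rewrite ?sn //.
    rewrite us andbT; apply/negP => xin.
    have := @leq_bigmax_seq nat (unzip1 s) xpredT id x xin isT.
    rewrite leqNgt => /negP; apply.
    exact: xs.
  by move=> p; rewrite inE => /orP[/eqP ->|/sX].
have /choice[Z ZP] : forall kn : K * nat, exists s : seq (nat * C),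
    [/\ uniq (unzip1 s), size s = kn.2.+1 &
    forall p : nat * C, p \in s -> X kn.1 p.1 /\ p.2 = h kn.1 p.1].
  by move=> [k n]; exact: enumX.
have [g gZ] := guessable_countable [::] Kg (fun k n => Z (k, n)).
(* [acc n] collects the pairs kept from the first n lists. *)
pose step (acc : seq (nat * C)) n :=
  if [seq p <- g n | p.1 \notin unzip1 acc] is p :: _ then p :: acc else acc.
pose acc := fix acc n := if n is m.+1 then step (acc m) m else [::].
have acc_size n : (size (acc n) <= n)%N.
  elim: n => //= n IH; rewrite /step.
  by case: [seq p <- g n | _] => [|? ?]; [exact: leqW|exact: IH].
have acc_uniq n : uniq (unzip1 (acc n)).
  elim: n => //= n IH; rewrite /step.
  case E: [seq p <- g n | _] => [|p s] //=; rewrite IH andbT.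
  have : p \in [seq p <- g n | p.1 \notin unzip1 (acc n)] by rewrite E mem_head.
  by rewrite mem_filter => /andP[].
have acc_sub m n : (m <= n)%N -> {subset acc m <= acc n}.
  elim: n => [|n IH]; first by rewrite leqn0 => /eqP ->.
  rewrite leq_eqVlt => /orP[/eqP -> //|]; rewrite ltnS => /IH mn p /mn pn /=.
  by rewrite /step; case: [seq p <- g n | _] => //= q _; rewrite inE pn orbT.
have acc_fun m n x c c' : (x, c) \in acc m -> (x, c') \in acc n -> c = c'.
  move=> /(acc_sub _ _ (leq_maxl m n)) + /(acc_sub _ _ (leq_maxr m n)).
  elim: (acc _) (acc_uniq (maxn m n)) => //= -[y b] s IH /andP[/= ys us].
  rewrite !inE => /orP[/eqP[-> ->]|xc] /orP[/eqP[]|xc'] //.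
  - by move: ys => /negP[]; apply/mapP; exists (y, c').
  - by move=> xy _; move: ys => /negP[]; rewrite -xy; apply/mapP; exists (x, c).
  - exact: IH.
have /choice[G GP] : forall x, exists c, forall n c', (x, c') \in acc n -> c = c'.
  move=> x; have [[n [c xc]]|nx] := pselect (exists n c, (x, c) \in acc n).
    by exists c => m c'; exact: acc_fun xc.
  by exists c0 => n c xc; case: nx; exists n, c.
exists G => k; have [n gn] := gZ k.
have [us sn sX] := ZP (k, n); rewrite -gn /= in us sn sX.
have : has (fun p => p.1 \notin unzip1 (acc n)) (g n).
  rewrite -[has _ _]negbK -all_predC; apply/negP => /allP sub.
  have := @uniq_leq_size _ (unzip1 (g n)) (unzip1 (acc n)) us.
  rewrite !size_map sn ltnNge acc_size => /(_ _)/negP[] //.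
  by move=> x /mapP[p /sub/=/negPn + ->].
rewrite has_filter; case E: [seq p <- g n | _] => [//|[x c] s] _.
have xg : (x, c) \in g n.
  have : (x, c) \in [seq p <- g n | p.1 \notin unzip1 (acc n)].
    by rewrite E mem_head.
  by rewrite mem_filter => /andP[].
have [/= Xx cx] := sX _ xg.
exists x => //; rewrite -cx; apply: (GP _ n.+1).
by rewrite /= /step E mem_head.
Qed.

(** There are only finitely many strings of length n, and they can be treated
    one after the other: lengthening the pattern does not spoil the strings
    already treated.  This is where the binary tree is used rather than the tree
    of all finite sequences of numbers. *)
Lemma dense_uniform_window (U : set (seq bool)) n :
  (forall s, exists t, U (s ++ t)) ->
  exists d, (n < d)%N /\ exists t : nat -> bool, forall y : nat -> bool,
    (forall i, n <= i < d -> y i = t i)%N -> exists m, U (mkseq y m).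
Proof.
move=> Ud.
have [w wP] : exists w, forall s, s \in map val (enum {:n.-tuple bool}) ->
    exists2 p, prefix p (s ++ w) & U p.
  elim: (map val _) => [|s L [w IH]]; first by exists [::].
  have [u Uu] := Ud (s ++ w); exists (w ++ u) => r.
  rewrite inE catA => /orP[/eqP ->|/IH[p pw Up]].
    by exists ((s ++ w) ++ u) => //; exact: prefix_refl.
  by exists p => //; rewrite (prefix_trans pw)// prefix_prefix.
exists (n + size w).+1; split; first by rewrite ltnS leq_addr.
exists (fun i => nth false w (i - n)) => y yw.
have [|p pw Up] := wP (mkseq y n).
  have sz : size (mkseq y n) == n by rewrite size_mkseq.
  by apply/mapP; exists (Tuple sz); rewrite ?mem_enum.
have yE : mkseq y (n + size w) = mkseq y n ++ w.
  rewrite /mkseq iotaD map_cat; congr (_ ++ _).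
  apply: (@eq_from_nth _ false); rewrite ?size_map ?size_iota // => i iw.
  rewrite (nth_map 0%N) ?size_iota // nth_iota // add0n yw ?addKn //.
  by rewrite leq_addr ltnS leq_add2l ltnW.
exists (size p); move: pw; rewrite -yE prefixE => /eqP pE.
suff -> : mkseq y (size p) = p by [].
have szp : (size p <= n + size w)%N.
  by rewrite -pE size_take size_mkseq; case: ltnP => // /ltnW.
by rewrite -{2}pE /mkseq -map_take take_iota (minn_idPl szp).
Qed.

(** The last two lemmas combine: the partition catches windows of each dense
    set in infinitely many pieces, and a guess of the patterns on these pieces is
    correct on one of them. *)
Lemma guessable_generic_branch K :
  cardinal_le (K * nat)%type K -> guessable K nat -> generic_branch K.
Proof.
move=> KN Kg U Ud.
have /choice[d dP] : forall kn : K * nat, exists d, (kn.2 < d)%N /\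
    exists t : nat -> bool, forall y : nat -> bool,
    (forall i, kn.2 <= i < d -> y i = t i)%N -> exists m, U kn.1 (mkseq y m).
  by move=> [k n]; exact: dense_uniform_window.
have [|j [j0 jS] jP] := @guessable_interval_partition K (fun k n => d (k, n)) KN Kg.
  by move=> k n; have [] := dP (k, n).
(* The piece [j i, j i.+1) is good for k when some pattern on it forces the
   branch into [U k]. *)
pose good k i (t : nat -> bool) := forall y : nat -> bool,
  (forall x, j i <= x < j i.+1 -> y x = t x)%N -> exists m, U k (mkseq y m).
have /choice[t tP] : forall ki : K * nat, exists t : nat -> bool,
    (exists t, good ki.1 ki.2 t) -> good ki.1 ki.2 t.
  move=> [k i] /=; have [[t tg]|nt] := pselect (exists t, good k i t).
    by exists t.
  by exists (fun=> false).
have [|G GP] := @guessable_on_infinite K _ [::]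
    (fun k => [set i | exists t, good k i t])
    (fun k i => mkseq (t (k, i)) (j i.+1)) Kg.
  move=> k N; have [i [Ni [n [jn dn]]]] := jP k N; exists i => //=.
  have [_ [u uP]] := dP (k, n); exists u => y yu; apply: uP => x /= /andP[nx xd].
  by apply: yu; rewrite (leq_trans jn nx) (leq_trans xd dn).
have /choice[b bP] : forall x, exists i, (j i <= x < j i.+1)%N.
  by move=> x; have [|i []] := @strict_mono_bracket j 0 x jS; rewrite ?j0 //; exists i.
(* [b x] is the piece containing x, and [G i] guesses the values of the branch
   on the whole initial segment below the end of the i-th piece. *)
exists (fun x => nth false (G (b x)) x) => k.
have [i /= /(tP (k, i))/= gi Gi] := GP k.
apply: gi => x /andP[jx xj].
suff -> : b x = i by rewrite Gi nth_mkseq.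
have j_mono : {mono j : m n / (m <= n)%N}.
  by apply: leq_mono; apply: homo_ltn => // ? ? ?; exact: ltn_trans.
have /andP[bx xb] := bP x.
have lt_of_j m n : (j m < j n.+1)%N -> (m <= n)%N.
  by rewrite (leqW_mono j_mono).
apply/eqP; rewrite eqn_leq; apply/andP; split; apply: lt_of_j.
  exact: leq_ltn_trans bx xj.
exact: leq_ltn_trans jx xb.
Qed.

(** * Theta-dense sets and the game *)

Section theta_dense_theory.
Variable X : topologicalType.

Lemma theta_dense_meets (D V : set X) :
  theta_dense X D -> open V -> V !=set0 -> closure V `&` D !=set0.
Proof.
move=> Dd Vo [x Vx]; have : theta_closure D x by rewrite [theta_closure D]Dd.
by apply; exact: open_nbhs_nbhs.
Qed.

(** Closures are monotone, so meeting the closures of the members of a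
    theta-pi-base suffices. *)
Lemma theta_pi_base_dense (B : set (set X)) (D : set X) :
  theta_pi_base B -> (forall V, B V -> closure V `&` D !=set0) ->
  theta_dense X D.
Proof.
move=> [_ Bpi] BD; apply/seteqP; split=> // x _ U; rewrite nbhsE => -[W [Wo Wx] WU].
have [|V BV VW] := Bpi W Wo; first by exists x.
have [z [Vz Dz]] := BD V BV; exists z; split=> //.
apply: (closureS WU); have /closure_id -> := @closed_closure _ W.
exact: closureS Vz.
Qed.

Lemma theta_dense_enum (D : set X) : [set: X] !=set0 ->
  cardinal_eq (delta_theta X) nat -> theta_dense X D ->
  exists c : nat -> X, range c `<=` D /\ theta_dense X (range c).
Proof.
move=> [x0 _] dX Dd.
have [dN Nd] : cardinal_le (delta_theta X) nat /\ cardinal_le nat (delta_theta X).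
  by move: dX; rewrite /cardinal_eq card_eq_le => /andP[].
have /cardinal_leP[e _] := Nd.
have [[_ /(_ D Dd)[C [CD Cd CL]]] _] := least_cardinal_inhabited (e 0%N).
have [| |c cC] := @cardinal_le_enum _ C nat.
- by apply: cardinal_le_trans dN; exact: cardinal_le_set.
- by have [z []] := theta_dense_meets Cd openT (ex_intro _ x0 I); exists z.
by exists c; rewrite cC.
Qed.

Lemma pi_thetaP : is_least_cardinal (fun L => exists V : set (set X),
  theta_pi_base V /\ (V #= [set: L])%card) (pi_theta X).
Proof.
apply: (@least_cardinalP _ [set V : set X | open V /\ V !=set0]).
  by move=> L M LM [V [Vpi VL]]; exists V; split=> //; exact: card_eq_trans LM.
exists [set V : set X | open V /\ V !=set0]; split; last exact: card_setT_sym.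
by split=> // U Uo U0; exists U => //; exact: subset_closure.
Qed.

Lemma theta_pi_base_enum K : [set: X] !=set0 -> cardinal_le (pi_theta X) K ->
  exists V : K -> set X, theta_pi_base (range V).
Proof.
move=> [x0 _] piK; have [[V [Vpi VL]] _] := pi_thetaP.
have [| |c cV] := @cardinal_le_enum _ V K.
- apply: cardinal_le_trans piK; apply: cardinal_le_set.
  by move: VL; rewrite card_eq_le => /andP[].
- by have [_ /(_ setT openT (ex_intro _ x0 I))[W VW _]] := Vpi; exists W.
by exists c; rewrite cV.
Qed.

End theta_dense_theory.

(** A bit sequence y codes the sequence of numbers n |-> [first_true y n], the
    length of the block of zeros starting at n.  These blocks overlap, which
    avoids parsing: a true bit at n determines all codes up to n and leaves the
    code at n + 1 free. *)
Definition first_true (y : nat -> bool) (n : nat) : nat :=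
  if pselect (exists k, y (n + k)%N) is left h then ex_minn h else 0%N.

Lemma first_trueE (y : nat -> bool) n k :
  y (n + k)%N -> (forall i, i < k -> ~~ y (n + i))%N -> first_true y n = k.
Proof.
move=> yk ylt; rewrite /first_true; case: pselect => [h|[]]; last by exists k.
case: ex_minnP => m ym mmin; apply/eqP; rewrite eqn_leq mmin //=.
by rewrite leqNgt; apply/negP => /ylt; rewrite ym.
Qed.

Section generic_play.
Variables (T : Type) (c : seq T -> nat -> T).

Definition play (y : nat -> bool) : nat -> seq T :=
  fix play n := if n is m.+1
    then rcons (play m) (c (play m) (first_true y m)) else [::].

Definition move_at y n := c (play y n) (first_true y n).

Lemma mkseq_move_at y n : mkseq (move_at y) n = play y n.
Proof. by elim: n => // n IH; rewrite mkseqS IH. Qed.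

Lemma eq_play y z n :
  (forall i, i < n -> first_true y i = first_true z i)%N -> play y n = play z n.
Proof.
elim: n => //= n IH yz; rewrite IH; first by rewrite yz.
by move=> i lt_in; rewrite yz // ltnW.
Qed.

(** Append a true bit to s: this fixes the position of the game after
    [size s] + 1 moves.  From that position some answer m lies in P, and m zeros
    followed by a true bit make TWO choose it. *)
Lemma generic_move (P : set T) (s : seq bool) :
  (forall h, exists m, P (c h m)) ->
  exists t, forall y, mkseq y (size (s ++ t)) = s ++ t -> exists n, P (move_at y n).
Proof.
move=> Pc; set N := size s.
have s1N (y : nat -> bool) m : mkseq y (size (s ++ true :: nseq m false ++ [:: true])) =
    s ++ true :: nseq m false ++ [:: true] ->
    [/\ forall i, (i < N)%N -> y i = nth false s i, y N,
        forall i, (i < m)%N -> ~~ y (N.+1 + i)%N & y (N.+1 + m)%N].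
  move=> yE; have yn i : (i < N + m.+2)%N ->
      y i = nth false (s ++ true :: nseq m false ++ [:: true]) i.
    move=> im; rewrite -yE nth_mkseq // size_cat /= size_cat /= size_nseq.
    by rewrite addn1.
  split.
  - by move=> i iN; rewrite yn ?nth_cat ?iN // (leq_trans iN) // leq_addr.
  - by rewrite yn ?nth_cat ?ltnn ?subnn // -addn1 leq_add2l.
  - move=> i im; rewrite yn; last by rewrite addSn -addnS ltn_add2l ltnW.
    rewrite nth_cat ltnNge addSn -addnS leq_addr /= addKn /= nth_cat size_nseq im.
    by rewrite nth_nseq im.
  - rewrite yn; last by rewrite addSn -addnS ltn_add2l.
    rewrite nth_cat ltnNge addSn -addnS leq_addr /= addKn /= nth_cat.
    by rewrite size_nseq ltnn subnn.
(* Any branch through the first true bit leads to this position; [y0] is one. *)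
pose y0 i := nth false (s ++ [:: true]) i.
have [m Pm] := Pc (play y0 N.+1).
exists (true :: nseq m false ++ [:: true]) => y /s1N[ys yN yl ym].
exists N.+1; rewrite /move_at (@first_trueE y N.+1 m) //.
suff -> : play y N.+1 = play y0 N.+1 by [].
have yy0 i : (i <= N)%N -> y i = y0 i.
  rewrite leq_eqVlt => /orP[/eqP ->|iN].
    by rewrite yN /y0 nth_cat ltnn subnn.
  by rewrite ys // /y0 nth_cat iN.
apply: eq_play => i; rewrite ltnS => iN.
have ex : exists k, y (i + k)%N by exists (N - i)%N; rewrite subnKC.
have [k yk kmin] := ex_minnP ex.
have kN : (i + k <= N)%N.
  by rewrite -(subnKC iN) leq_add2l; apply: kmin; rewrite subnKC.
rewrite (@first_trueE y i k) // ?(@first_trueE y0 i k) //.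
- by rewrite -yy0.
- move=> j jk; rewrite -yy0; last by rewrite (leq_trans _ kN) // leq_add2l ltnW.
  by apply/negP => /kmin; rewrite leqNgt jk.
- by move=> j jk; apply/negP => /kmin; rewrite leqNgt jk.
Qed.

End generic_play.

(** The set attached to a member V of the theta-pi-base consists of the strings
    that force the play into the closure of V. *)
Lemma generic_branch_ONE K (X : topologicalType) :
  generic_branch K -> admissible_space K X ->
  ~ ONE_has_winning_strategy_G1 (theta_dense X) (theta_dense X).
Proof.
move=> KB [X0 _ _ dX piK] [sigma [sigmaD sigmaW]].
have [V Vpi] := theta_pi_base_enum X0 piK.
have /choice[c cP] : forall s, exists c : nat -> X,
    range c `<=` sigma s /\ theta_dense X (range c).
  by move=> s; exact: theta_dense_enum.
have [|y yP] := KB (fun k s => forall y, mkseq y (size s) = s ->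
    exists n, closure (V k) (move_at c y n)).
  move=> k s; apply: generic_move => h.
  have [Vo V0] : open (V k) /\ V k !=set0 by apply: (Vpi.1); exists k.
  by have [z [Vz [m _ cm]]] := theta_dense_meets (cP h).2 Vo V0; exists m; rewrite cm.
apply: (sigmaW (move_at c y)).
  by move=> n; rewrite mkseq_move_at; apply: (cP _).1; eexists.
apply: theta_pi_base_dense Vpi _ => _ [k _ <-].
have [n /(_ y)] := yP k; rewrite size_mkseq => /(_ erefl)[m Vm].
by exists (move_at c y m); split=> //; exists m.
Qed.

(** ONE ignores the moves of TWO and plays the given sequence. *)
Lemma not_S1_strategy (X : Type) (A B : set (set X)) :
  ~ S1 A B -> ONE_has_winning_strategy_G1 A B.
Proof.
move=> /existsNP[D /not_implyP[DA /forallNP nD]].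
exists (fun s => D (size s)); split=> [s|t tD Bt]; first exact: DA.
by apply: (nD t); split=> // n; have := tD n; rewrite size_mkseq.
Qed.

(** * Meager subsets of the line *)

Local Open Scope ring_scope.

Section real_line.
Variable R : realType.
Implicit Types (N : set R) (a b c d x z : R) (y : nat -> bool).

Lemma nowhere_dense_itvP N : nowhere_dense N <->
  forall a b, a < b -> exists c d, [/\ c < d, a <= c, d <= b &
    forall x, c < x < d -> ~ N x].
Proof.
split=> [Nnd a b ab|Nitv].
  have [z [azb nz]] : exists z, a < z < b /\ ~ closure N z.
    apply: contrapT => /forallNP nz.
    suff : interior (closure N) ((a + b) / 2) by rewrite Nnd.
    apply/nbhs_ballP; exists ((b - a) / 2) => /=; first lra.
    move=> z; rewrite /ball/= => abz; apply: contrapT => Nz; apply: (nz z).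
    by split=> //; move: abz; rewrite ltr_norml; lra.
  have /existsNP[U /not_implyP[/nbhs_ballP[e /= e0 eU] NU]] := nz.
  exists (Num.max a (z - e)), (Num.min b (z + e)); split.
  - by rewrite gt_max !lt_min; lra.
  - by rewrite le_max lexx.
  - by rewrite ge_min lexx.
  move=> x; rewrite gt_max lt_min => /andP[/andP[_ zx] /andP[_ xz]] Nx.
  by apply: NU; exists x; split=> //; apply: eU; rewrite /ball/= ltr_norml; lra.
apply/seteqP; split=> // x /nbhs_ballP[e /= e0 eN].
have [|c [d [cd xc dx Ncd]]] := Nitv (x - e) (x + e); first lra.
have /(_ (ball ((c + d) / 2) ((d - c) / 2)))[|w [Nw]] : closure N ((c + d) / 2).
- by apply: eN; rewrite /ball/= ltr_norml; lra.
- by apply/nbhs_ballP; exists ((d - c) / 2) => //=; lra.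
by rewrite /ball/= ltr_norml => wcd; apply: (Ncd w) => //; lra.
Qed.

Lemma nowhere_dense_meager N : nowhere_dense N -> meager N.
Proof. by exists (fun=> N); split=> //; rewrite bigcup_const. Qed.

(** The i-th digit measures x on the scale r to the right of q, where i codes
    the pair (q, r) of rationals.  The pole at q lets the digit take every value
    on small intervals next to q. *)
Definition real_code x (i : nat) : nat :=
  if (unpickle i : option (rat * rat)) is Some (q, r)
  then (Num.truncn (ratr r / (x - ratr q))).-1 else 0%N.

Lemma real_code_onto a b : a < b -> exists i, forall m, exists c d,
  [/\ c < d, a <= c, d <= b & forall x, c < x < d -> real_code x i = m].
Proof.
move=> ab; have [q] := rat_in_itvoo ab; rewrite in_itv/= => /andP[aq qb].
have [|r] := @rat_in_itvoo _ 0 (b - ratr q); first lra.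
rewrite in_itv/= => /andP[r0 rb]; exists (pickle (q, r)) => m.
have m1 : 0 < m.+1%:R :> R by [].
have m2 : 0 < m.+2%:R :> R by [].
exists (ratr q + ratr r / m.+2%:R), (ratr q + ratr r / m.+1%:R); split.
- by rewrite ltrD2l ltr_pM2l // ltf_pV2 ?posrE // ltr_nat.
- by rewrite ltW // (lt_trans aq) // ltrDl divr_gt0.
- have : ratr r / m.+1%:R <= ratr r :> R; last first.
    by move: (ratr r / m.+1%:R) => t; lra.
  by rewrite ler_pdivrMr // ler_pMr // ler1n.
move=> x /andP[]; rewrite -ltrBrDl => ru; rewrite -ltrBlDl => ur.
rewrite /real_code pickleK; set u := x - ratr q in ru ur *.
have u0 : 0 < u by apply: lt_trans ru; rewrite divr_gt0.
rewrite (@truncn_def _ _ m.+1) //.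
rewrite ler_pdivlMr // ltr_pdivrMr //.
move: ru ur; rewrite ltr_pdivrMr // ltr_pdivlMr // => + /ltW.
by rewrite ![u * _]mulrC => -> ->.
Qed.

(** If no g guessed all [Z k], then in particular the code of no real would, so
    the sets of reals whose code misses [Z k] would cover the line; they are
    nowhere dense because some digit takes the value [Z k i] on a subinterval of
    any interval. *)
Lemma cov_meager_guessable K : cardinal_lt K (cov_meager R) -> guessable K nat.
Proof.
move=> [_ covK] Z; apply: contrapT => /forallNP noguess; apply: covK.
have [|cov0] := pselect (inhabited (cov_meager R)); last first.
  apply/cardinal_leP.
  by exists (fun l : cov_meager R => False_rect K (cov0 (inhabits l))) => l; case: cov0.
move=> [/least_cardinal_inhabited[_ cov_le]].
pose N k := [set x | forall i, real_code x i <> Z k i].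
apply: (@cardinal_le_trans _ (range N)); last first.
  by apply: cardinal_le_set; exact: card_image_le.
apply: cov_le; exists (range N); split.
- move=> _ [k _ <-]; apply: nowhere_dense_meager; apply/nowhere_dense_itvP => a b ab.
  have [i /(_ (Z k i))[c [d [cd ac db cdZ]]]] := real_code_onto ab.
  by exists c, d; split=> // x /cdZ xZ /(_ i).
- apply/seteqP; split=> // x _.
  have /existsNP[k /forallNP kx] := noguess (real_code x).
  by exists (N k) => //; exists k.
- exact: card_setT_sym.
Qed.

Definition binary_sum y n : R := \sum_(i < n) (y i)%:R / 2 ^+ i.+1.

(** The real with binary expansion y, as a supremum of partial sums. *)
Definition binary_real y : R := sup (range (binary_sum y)).

Lemma binary_sum_bounds y m n : (m <= n)%N ->
  binary_sum y m <= binary_sum y n <= binary_sum y m + (2 ^- m - 2 ^- n).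
Proof.
elim: n => [|n IH]; first by rewrite leqn0 => /eqP ->; rewrite subrr addr0 lexx.
rewrite leq_eqVlt => /orP[/eqP ->|]; first by rewrite subrr addr0 lexx.
rewrite ltnS => /IH; rewrite /binary_sum big_ord_recr /=.
set A := \sum_(i < m) _; set B := \sum_(i < n) _.
have -> : 2 ^- n = 2 * 2 ^- n.+1 :> R.
  by rewrite exprS invfM mulrA divff ?mul1r.
have : 0 < 2 ^- n.+1 :> R by rewrite invr_gt0 exprn_gt0.
by set e := 2 ^- n.+1; case: (y n) => /=; lra.
Qed.

Lemma binary_real_bounds y n :
  binary_sum y n <= binary_real y <= binary_sum y n + 2 ^- n.
Proof.
have ub m : binary_sum y m <= binary_sum y n + 2 ^- n.
  have p k : 0 < 2 ^- k :> R by rewrite invr_gt0 exprn_gt0.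
  have := p m; have := p n.
  by case: (leqP m n) => [|/ltnW] /(binary_sum_bounds y); lra.
have hub : ubound (range (binary_sum y)) (binary_sum y n + 2 ^- n).
  by move=> _ [m _ <-].
apply/andP; split.
  by apply: ub_le_sup; [exists (binary_sum y n + 2 ^- n)|exists n].
by apply: ge_sup => //; exists (binary_sum y 0), 0%N.
Qed.

Lemma eq_binary_sum y y' n :
  (forall i, (i < n)%N -> y i = y' i) -> binary_sum y n = binary_sum y' n.
Proof. by move=> yy; apply: eq_bigr => i _; rewrite yy. Qed.

Definition binary_prefix (s : seq bool) := binary_sum (nth false s) (size s).

Lemma binary_prefix_rcons s (b : bool) :
  binary_prefix (rcons s b) = binary_prefix s + b%:R / 2 ^+ (size s).+1.
Proof.
rewrite /binary_prefix size_rcons /binary_sum big_ord_recr /= nth_rcons ltnn eqxx.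
by congr (_ + _); apply: eq_bigr => i _; rewrite nth_rcons ltn_ord.
Qed.

(** One more binary digit halves the interval that contains z. *)
Lemma binary_approx s z n :
  binary_prefix s <= z <= binary_prefix s + 2 ^- size s ->
  exists2 t, size t = n &
    binary_prefix (s ++ t) <= z <= binary_prefix (s ++ t) + 2 ^- size (s ++ t).
Proof.
move=> sz; elim: n => [|n [t tn]]; first by exists [::]; rewrite ?cats0.
set u := s ++ t => uz.
have e2 : 2 ^- size u = 2 * 2 ^- (size u).+1 :> R.
  by rewrite exprS invfM mulrA divff ?mul1r.
exists (rcons t (binary_prefix u + 2 ^- (size u).+1 <= z)).
  by rewrite size_rcons tn.
rewrite -rcons_cat -/u binary_prefix_rcons size_rcons; rewrite e2 in uz.
set e := 2 ^- (size u).+1 in uz *.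
by case: (lerP (binary_prefix u + e) z) => /= ez; move: uz ez; lra.
Qed.

Lemma half_power_lt (e : R) : 0 < e -> exists n, 2 ^- n < e.
Proof.
move=> e0; exists (Num.truncn e^-1).+1.
rewrite -[X in _ < X]invrK ltf_pV2 ?posrE ?invr_gt0 ?exprn_gt0 //.
apply: lt_trans (truncnS_gt _) _.
by rewrite -natrX ltr_nat ltn_expl.
Qed.

Lemma nowhere_dense_avoid N s : nowhere_dense N -> exists t, forall y,
  mkseq y (size (s ++ t)) = s ++ t -> ~ N (binary_real y).
Proof.
move=> /nowhere_dense_itvP Nitv.
have p0 : 0 < 2 ^- size s :> R by rewrite invr_gt0 exprn_gt0.
have [|c [d [cd sc ds Ncd]]] :=
  Nitv (binary_prefix s) (binary_prefix s + 2 ^- size s); first lra.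
have [|n nlt] := @half_power_lt ((d - c) / 2); first lra.
have [|t tn tz] := @binary_approx s ((c + d) / 2) n; first lra.
exists t => y yE; apply: Ncd.
have yP : binary_sum y (size (s ++ t)) = binary_prefix (s ++ t).
  by apply: eq_binary_sum => i ilt; rewrite -yE nth_mkseq.
have := binary_real_bounds y (size (s ++ t)); rewrite yP.
have : 2 ^- size (s ++ t) <= 2 ^- n :> R; last by lra.
rewrite lef_pV2 ?posrE ?exprn_gt0 // ler_eXn2l ?ltr1n //.
by rewrite size_cat tn leq_addl.
Qed.

(** A branch generic for the K * nat nowhere dense sets that make up K meager
    sets gives a real outside all of them. *)
Lemma generic_branch_cov_meager K :
  infinite_set [set: K] -> generic_branch K -> cardinal_lt K (cov_meager R).
Proof.
move=> Kinf KB; apply: contrapT => /cardinal_ltNge covK.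
have [| |] := @least_cardinalP (fun L => exists F : set (set R),
    [/\ forall A, F A -> meager A, \bigcup_(A in F) A = [set: R]
      & (F #= [set: L])%card]) (range (@set1 R)).
- move=> L M LM [F [Fm FR FL]]; exists F; split=> //; exact: card_eq_trans LM.
- exists (range (@set1 R)); split; last exact: card_setT_sym.
    move=> _ [x _ <-]; apply: nowhere_dense_meager; apply/nowhere_dense_itvP => a b ab.
    have [xm|xm] := leP x ((a + b) / 2).
      exists ((a + b) / 2), b; split => //; [lra|lra|].
      by move=> z zab zx; move: zab; rewrite zx; lra.
    exists a, ((a + b) / 2); split => //; [lra|lra|].
    by move=> z zab zx; move: zab; rewrite zx; lra.
  by apply/seteqP; split=> // x _; exists [set x] => //; exists x.
rewrite -/(cov_meager R) => -[F [Fm FR FL]] _.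
have [| |A AF] := @cardinal_le_enum _ F K.
- apply: cardinal_le_trans covK; apply: cardinal_le_set.
  by move: FL; rewrite card_eq_le => /andP[].
- by have : [set: R] 0 by []; rewrite -FR => -[B FB _]; exists B.
have /choice[N NP] : forall k, exists N : nat -> set R,
    (forall n, nowhere_dense (N n)) /\ A k = \bigcup_n N n.
  by move=> k; apply: Fm; rewrite -AF; exists k.
have [|y yP] := generic_branch_le (cardinal_le_mul_nat Kinf) KB
  (U := fun kn s => forall y, mkseq y (size s) = s -> ~ N kn.1 kn.2 (binary_real y)).
  by move=> [k n] s; apply: nowhere_dense_avoid; have [] := NP k.
have : [set: R] (binary_real y) by [].
rewrite -FR -AF => -[_ [k _ <-]]; have [_ ->] := NP k => -[n _ Ny].
by have [m /(_ y)] := yP (k, n); rewrite size_mkseq => /(_ erefl).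
Qed.

End real_line.

Local Close Scope ring_scope.

(** * The countable test space of a family of functions *)

Lemma eventually_on_list (K : Type) (Q : K -> nat -> Prop) (A : seq K) :
  (forall k, exists N, forall M, (N <= M)%N -> Q k M) ->
  exists N, forall k, List.In k A -> forall M, (N <= M)%N -> Q k M.
Proof.
move=> Qev; elim: A => [|a A [N NA]]; first by exists 0%N.
have [M MQ] := Qev a; exists (maxn M N) => k [<- L|kA L]; rewrite geq_max.
  by move=> /andP[ML _]; exact: MQ.
by move=> /andP[_ NL]; exact: NA.
Qed.

Lemma onth_In (T : Type) (A : seq T) j a : onth A j = Some a -> List.In a A.
Proof.
by elim: A j => [|b A IH] [|j] //=; [move=> [->]; left|move=> /IH; right].
Qed.

Lemma In_onth (T : Type) (A : seq T) a : List.In a A ->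
  exists2 j, (j < size A)%N & onth A j = Some a.
Proof.
elim: A => [//|b A IH] /= [->|/IH[j jA Aj]]; first by exists 0%N.
by exists j.+1.
Qed.

(** A point (n, p) carries a level n and a list p of finite sequences, each a
    guess at an initial segment of a function.  The family Z enters the type
    only to select the topology. *)
Definition guess_space (K : Type) (Z : K -> nat -> nat) : Type :=
  (nat * seq (seq nat))%type.

Section guess_space.
Variables (K : Type) (Z : K -> nat -> nat).
Local Notation X := (guess_space Z).

HB.instance Definition _ := Choice.on X.

(** The j-th sequence of a point of level n counts only if it is long enough to
    include the argument coded by (n, j).  Thus every counted correct guess at
    level n is correct at an argument reserved for n and j. *)
Definition guesses (f : nat -> nat) : set X := [set x | exists j,
  (pickle (x.1, j) < size (nth [::] x.2 j))%N /\
  nth [::] x.2 j = mkseq f (size (nth [::] x.2 j))].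

(** The topology makes the sets [guesses (Z k)] clopen, and excluding the other
    points with at most e sequences makes it T1 without affecting density. *)
Definition guess_nbhs (x : X) (A : seq K) (e : nat) : set X :=
  [set y | ((size y.2 <= e)%N -> y = x) /\
    forall k, List.In k A -> (guesses (Z k) y <-> guesses (Z k) x)].

Definition guess_open (V : set X) : Prop :=
  forall x, V x -> exists A e, guess_nbhs x A e `<=` V.

Lemma guess_nbhs_refl x A e : guess_nbhs x A e x.
Proof. by []. Qed.

Lemma guess_openT : guess_open setT.
Proof. by move=> x _; exists [::], 0%N. Qed.

Lemma guess_openI : setI_closed guess_open.
Proof.
move=> U V Uo Vo x [/Uo[A [d AU]] /Vo[B [e BV]]].
exists (A ++ B), (maxn d e) => y [yx yAB]; split.
  apply: AU; split=> [yd|k kA]; first by apply: yx; rewrite leq_max yd.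
  by apply: yAB; apply: List.in_or_app; left.
apply: BV; split=> [ye|k kB]; first by apply: yx; rewrite leq_max ye orbT.
by apply: yAB; apply: List.in_or_app; right.
Qed.

Lemma guess_open_bigU (I : Type) (f : I -> set X) :
  (forall i, guess_open (f i)) -> guess_open (\bigcup_i f i).
Proof.
move=> fo x [i _ /fo[A [e Af]]]; exists A, e => y /Af fy; by exists i.
Qed.

HB.instance Definition _ := isOpenTopological.Build X
  guess_openT guess_openI guess_open_bigU.

Lemma guess_space_openP (V : set X) : open V <-> guess_open V.
Proof. by []. Qed.

Lemma open_guess_nbhs x A e : open (guess_nbhs x A e).
Proof.
apply/guess_space_openP => y [yx yA]; exists A, e => z [zy zA]; split.
  by move=> ze; have zy' := zy ze; rewrite zy'; apply: yx; rewrite -zy'.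
by move=> k kA; rewrite zA// yA.
Qed.


Lemma nbhs_guessP (P : set X) (x : X) :
  nbhs x P <-> exists A e, guess_nbhs x A e `<=` P.
Proof.
rewrite nbhsE; split=> [[W [/guess_space_openP Wo Wx] WP]|[A [e xAe]]].
  by have [A [e AW]] := Wo x Wx; exists A, e => y /AW/WP.
exists (guess_nbhs x A e) => //; split; [exact: open_guess_nbhs|].
exact: guess_nbhs_refl.
Qed.

Lemma mkseq_separation (A : seq K) : exists N, forall k k',
  List.In k A -> List.In k' A -> forall M, (N <= M)%N ->
  mkseq (Z k) M = mkseq (Z k') M -> Z k = Z k'.
Proof.
have [|N NP] := @eventually_on_list K (fun k M => forall k', List.In k' A ->
    mkseq (Z k) M = mkseq (Z k') M -> Z k = Z k') A; last first.
  by exists N => k k' kA k'A M NM; exact: NP.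
move=> k; have [|N NP] := @eventually_on_list K (fun k' M =>
    mkseq (Z k) M = mkseq (Z k') M -> Z k = Z k') A; last first.
  by exists N => M NM k' k'A; exact: NP.
move=> k'; have [->|] := pselect (Z k = Z k'); first by exists 0%N.
rewrite funeqE => /existsNP[i ni]; exists i.+1 => M iM kk'; exfalso; apply: ni.
by rewrite -(nth_mkseq 0%N (Z k) iM) kk' nth_mkseq.
Qed.

(** The sets [guesses (Z k)] are independent at every level: for the functions in
    A that x guesses, write down initial segments long enough to be counted and
    to distinguish all functions of A.  Padding with empty sequences makes the
    list as long as desired. *)
Lemma guess_dense (x : X) (A : seq K) (n r : nat) :
  exists2 p, (r < size p)%N &
    forall k, List.In k A -> (guesses (Z k) ((n, p) : X) <-> guesses (Z k) x).
Proof.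
have [N NP] := mkseq_separation A.
pose entry j := if onth A j is Some k then
  if `[< guesses (Z k) x >] then mkseq (Z k) (N + (pickle (n, j)).+1) else [::]
  else [::].
exists (mkseq entry (size A + r.+1)); first by rewrite size_mkseq addnS ltnS leq_addl.
have nthE j : nth [::] (mkseq entry (size A + r.+1)) j =
    if (j < size A + r.+1)%N then entry j else [::].
  by case: ltnP => jA; [rewrite nth_mkseq|rewrite nth_default ?size_mkseq].
move=> k kA; split=> [[j []]|kx] /=.
  rewrite nthE; case: ifP => // _; rewrite /entry.
  case Aj: (onth A j) => [k'|] //; case: asboolP => // k'x _.
  rewrite size_mkseq => /NP <- //; [exact: onth_In Aj|exact: leq_addr].
have [j jA Aj] := In_onth kA; exists j.
rewrite /= nthE ltn_addr // /entry Aj; case: asboolP => // _.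
by rewrite size_mkseq leq_addl.
Qed.

Lemma guess_nbhs_infinite (x : X) (A : seq K) (e n r : nat) :
  exists2 p, (r < size p)%N & guess_nbhs x A e ((n, p) : X).
Proof.
have [p pr pA] := guess_dense x A n (maxn r e).
move: pr; rewrite gtn_max => /andP[rp ep]; exists p => //; split=> //=.
by rewrite leqNgt ep.
Qed.

Lemma theta_dense_level n : theta_dense X [set x | x.1 = n].
Proof.
apply/seteqP; split=> // x _ U xU; have [A [e AU]] := (nbhs_guessP U x).1 xU.
have [p _ px] := guess_nbhs_infinite x A e n 0.
by exists (n, p); split=> //; apply: subset_closure; exact: AU.
Qed.

Lemma guesses_mkseq f m :
  (pickle (0%N, 0%N) < m)%N -> guesses f ((0%N, [:: mkseq f m]) : X).
Proof. by move=> lt_m; exists 0%N; rewrite /= size_mkseq. Qed.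

Lemma open_guesses k : open (guesses (Z k)).
Proof.
by apply/guess_space_openP => x kx; exists [:: k], 0%N => y [_ yx]; apply/yx => //; left.
Qed.

Lemma closed_guesses k : closed (guesses (Z k)).
Proof.
rewrite -[guesses _]setCK; apply: open_closedC; apply/guess_space_openP => x kx.
exists [:: k], 0%N => y [_ yx] ky; apply: kx; apply/yx => //; by left.
Qed.

Lemma guess_space_accessible : accessible_space X.
Proof.
move=> x y xy; exists (guess_nbhs x [::] (size y.2)); split.
- exact: open_guess_nbhs.
- by rewrite in_setE; exact: guess_nbhs_refl.
- rewrite in_setE => -[/(_ (leqnn _)) yx _]; by rewrite yx eqxx in xy.
Qed.

Lemma guess_space_isolated : isolated [set: X] = set0.
Proof.
apply/seteqP; split=> // x [_ [V xV]]; rewrite setIT => Vx.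
have [A [e AV]] := (nbhs_guessP V x).1 xV.
have [p xp /AV] := guess_nbhs_infinite x A e 0 (size x.2).
by rewrite Vx => xE; move: xp; rewrite -xE ltnn.
Qed.

Lemma guess_space_delta_theta : cardinal_eq (delta_theta X) nat.
Proof.
apply: least_cardinal_unique; split; last by move=> M [].
split=> [|D Dd]; first exact: cardinal_le_refl.
by exists D; split=> //; exact: (@countableP (nat * seq (seq nat))%type D).
Qed.

Lemma guess_space_pi_theta :
  infinite_set [set: K] -> cardinal_le (pi_theta X) K.
Proof.
move=> Kinf; pose b (i : X * seq K * nat) := guess_nbhs i.1.1 i.1.2 i.2.
have [_ /(_ (range b)) pi_le] := pi_thetaP X.
apply: (@cardinal_le_trans _ (range b)).
  apply: pi_le; exists (range b); split; last exact: card_setT_sym.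
  split=> [_ [[[x A] e] _ <-]|U /guess_space_openP Uo [x /Uo[A [e AU]]]].
    by split; [exact: open_guess_nbhs|exists x; exact: guess_nbhs_refl].
  exists (guess_nbhs x A e); first by exists (x, A, e).
  by apply: subset_trans AU _; exact: subset_closure.
apply: (@cardinal_le_trans _ (X * seq K * nat)%type).
  by apply: cardinal_le_set; exact: card_image_le.
have /cardinal_leP[s s_inj] := cardinal_le_seq Kinf.
have /cardinal_leP[c c_inj] := cardinal_le_mul_nat Kinf.
apply/cardinal_leP.
exists (fun i => c (c (s i.1.2, pickle (i.1.1 : nat * seq (seq nat))), i.2)).
by move=> [[x A] e] [[y B] d] /= /c_inj[/c_inj[/s_inj -> /(pcan_inj pickleK) ->] ->].
Qed.

Lemma guess_space_admissible :
  infinite_set [set: K] -> admissible_space K X.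
Proof.
move=> Kinf; split.
- by exists ((0%N, [::]) : X).
- exact: guess_space_accessible.
- exact: guess_space_isolated.
- exact: guess_space_delta_theta.
- exact: guess_space_pi_theta.
Qed.

(** Select one point [b n] at each level n and let g take, at the argument coded
    by (n, j), the value given there by the j-th sequence of [b n]; each argument
    receives at most one value.  As [guesses (Z k)] is clopen, theta-density of
    the selection puts some [b n] into it, and then g is correct at one
    argument. *)
Lemma S1_guess_space : S1 (theta_dense X) (theta_dense X) ->
  exists g : nat -> nat, forall k, exists i, g i = Z k i.
Proof.
move=> /(_ _ theta_dense_level)[b [b1 bd]].
exists (fun i => if unpickle i is Some nj then
  nth 0%N (nth [::] (b nj.1).2 nj.2) i else 0%N) => k.
have [x [xk [n _ bx]]] : closure (guesses (Z k)) `&` range b !=set0.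
  apply: theta_dense_meets bd (@open_guesses k) _.
  exists ((0%N, [:: mkseq (Z k) (pickle (0%N, 0%N)).+1]) : X).
  by apply: guesses_mkseq; exact: ltnSn.
have [j [jlt jE]] : guesses (Z k) (b n).
  by rewrite bx; move: xk; have /closure_id <- := @closed_guesses k.
rewrite b1 in jlt; exists (pickle (n, j)); rewrite pickleK /= jE nth_mkseq //.
Qed.

End guess_space.

Lemma S1_guessable K : infinite_set [set: K] ->
  (forall X : topologicalType, admissible_space K X ->
     S1 (theta_dense X) (theta_dense X)) -> guessable K nat.
Proof.
by move=> Kinf S1K Z; apply: S1_guess_space; apply: S1K; exact: guess_space_admissible.
Qed.

Unset Implicit Arguments.
Local Close Scope classical_set_scope.

(** * The equivalence *)

Theorem theorem5p5 (R : realType) (K : Type)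
    (K_infinite : infinite_set [set: K]%classic) :
  (cardinal_lt K (cov_meager R) <->
   forall X : topologicalType, admissible_space K X ->
     ~ ONE_has_winning_strategy_G1 (theta_dense X) (theta_dense X)) /\
  ((forall X : topologicalType, admissible_space K X ->
     ~ ONE_has_winning_strategy_G1 (theta_dense X) (theta_dense X)) <->
   forall X : topologicalType, admissible_space K X ->
     S1 (theta_dense X) (theta_dense X)).
Proof.
have ONE_of_lt : cardinal_lt K (cov_meager R) -> forall X : topologicalType,
    admissible_space K X ->
    ~ ONE_has_winning_strategy_G1 (theta_dense X) (theta_dense X).
  move=> /cov_meager_guessable Kg X; apply: generic_branch_ONE.
  exact: guessable_generic_branch (cardinal_le_mul_nat K_infinite) Kg.
have S1_of_ONE : (forall X : topologicalType, admissible_space K X ->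
      ~ ONE_has_winning_strategy_G1 (theta_dense X) (theta_dense X)) ->
    forall X : topologicalType, admissible_space K X ->
      S1 (theta_dense X) (theta_dense X).
  move=> noONE X XK; apply: contrapT => nS1; apply: (noONE X XK).
  exact: not_S1_strategy.
have lt_of_S1 : (forall X : topologicalType, admissible_space K X ->
      S1 (theta_dense X) (theta_dense X)) -> cardinal_lt K (cov_meager R).
  move=> S1K; apply: generic_branch_cov_meager => //.
  apply: guessable_generic_branch; first exact: cardinal_le_mul_nat.
  exact: S1_guessable.
by split; split; auto.
Qed.
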